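(* Let $0<\alpha<1$ and let $f(z)=\sum_{n=1}^\infty a_n z^n$ (so $f(0)=0$) be a function in the class $\mathcal{B}$. Then $$\sum_{n=1}^\infty \frac{\Gamma(n+1)}{\Gamma(n+1-\alpha)}\,|a_n|\, r^{n-\alpha} \;\le\; \frac{r^{1-\alpha}}{\Gamma(2-\alpha)}\qquad\text{for all } 0<r\le \rho(\alpha),$$ where $\rho(\alpha)$ is the minimum positive solution $r\in(0,1)$ of $$\sum_{n=2}^\infty \frac{\Gamma(n+1)}{\Gamma(n+1-\alpha)}\, r^n = \frac{r}{2\,\Gamma(2-\alpha)}.$$
   Context: $\mathbb{D}=\{z\in\mathbb{C}:|z|<1\}$. $\mathcal{B}$ denotes the class of analytic functions $f$ in $\mathbb{D}$ such that $|f(z)|<1$ for all $z\in\mathbb{D}$. $\Gamma$ is the Gamma function. The left-hand side is the majorant series (Bohr sum) of the Riemann–Liouville fractional derivative of $f$, $D^\alpha f(z)=\sum_{n} a_n\frac{\Gamma(n+1)}{\Gamma(n+1-\alpha)}z^{n-\alpha}$, with $r=|z|$. *)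

(* Defs.v *)
From Stdlib Require Import Reals Lra.
From Coquelicot Require Import Coquelicot.

Open Scope R_scope.

(* Euler's integral; it converges, and so is the true Gamma function, for 0 < x.
   Only such arguments occur in this development. *)
Definition Gamma (x : R) : R :=
  RInt_gen (fun t => Rpower t (x - 1) * exp (- t))
           (at_right 0) (Rbar_locally p_infty).

(* Factor by which the Riemann-Liouville derivative of order alpha multiplies
   the n-th coefficient: D^alpha z^n = frac_coef alpha n * z^(n - alpha). *)
Definition frac_coef (alpha : R) (n : nat) : R :=
  Gamma (INR n + 1) / Gamma (INR n + 1 - alpha).

Definition in_disk (z : C) : Prop := Cmod z < 1.

(* Analyticity is complex differentiability, hence K := C_AbsRing. Values of
   f outside the disk are irrelevant. *)
Definition analytic_in_disk (f : C -> C) : Prop :=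
  forall z : C, in_disk z ->
    ex_derive (K := C_AbsRing) (V := C_NormedModule) f z.

Definition class_B (f : C -> C) : Prop :=
  analytic_in_disk f /\ forall z : C, in_disk z -> Cmod (f z) < 1.

(* f(z) = sum_{n >= 1} a_n z^n on the disk. *)
Definition power_series_from_1 (f : C -> C) (a : nat -> C) : Prop :=
  a 0%nat = RtoC 0 /\
  forall z : C, in_disk z ->
    is_pseries (K := C_AbsRing) (V := C_NormedModule) a z (f z).

(* The series over n >= 2 is indexed by k = n - 2; using is_series makes its
   convergence part of the equation. *)
Definition radius_equation (alpha r : R) : Prop :=
  is_series (fun k : nat => frac_coef alpha (k + 2) * r ^ (k + 2))
            (r / (2 * Gamma (2 - alpha))).

Definition min_positive_solution (alpha rho : R) : Prop :=
  (0 < rho < 1 /\ radius_equation alpha rho) /\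
  forall s : R, 0 < s < 1 -> radius_equation alpha s -> rho <= s.

(* The n-th term of the majorant series of D^alpha f at |z| = r. *)
Definition bohr_term (alpha : R) (a : nat -> C) (r : R) (n : nat) : R :=
  frac_coef alpha n * Cmod (a n) * Rpower r (INR n - alpha).

(* Main.v *)
(* Integrating f(z)/z over a circle against the nonnegative kernel 1 + cos(n t + phi)
   gives |a_1| + |a_(n+1)| / 2 <= 1, i.e. |a_m| <= 2 (1 - |a_1|) for m >= 2. With
   c_n = Gamma(n+1) / Gamma(n+1-alpha) and S(r) = sum_(n >= 2) c_n r^n, the majorant
   series is therefore at most r^(-alpha) (c_1 |a_1| r + 2 (1 - |a_1|) S(r)), which is
   at most c_1 r^(1-alpha) as soon as S(r) <= c_1 r / 2. The quotient S(r) / r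
   ([frac_tail] below) is continuous and strictly increasing on [0, 1), vanishes at 0,
   and is at least c_1 at 1/2 because c_n is nondecreasing; so it takes the value
   c_1 / 2 exactly once, at rho. *)
Require Import Defs.
From Stdlib Require Import Reals Lra Lia.
From Coquelicot Require Import Coquelicot.

Open Scope R_scope.

(** * The Gamma function on [1, infinity) *)

(** For nonnegative [f] the integral grows with the interval, so the improper integral is the
    supremum over compact intervals. The second conjunct lets one compact interval bound [L] from
    below. *)
Lemma RInt_gen_nonneg_bounded (f : R -> R) (M : R) :
  (forall t, 0 < t -> continuous f t) ->
  (forall t, 0 < t -> 0 <= f t) ->
  (forall a b, 0 < a <= b -> RInt f a b <= M) ->
  exists L,
    is_RInt_gen f (at_right 0) (Rbar_locally p_infty) L /\
    forall a b, 0 < a <= b -> RInt f a b <= L.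
Proof.
intros Hc Hp HM.
assert (Hex : forall a b, 0 < a <= b -> ex_RInt f a b).
{ intros a b Hab. apply (ex_RInt_continuous (V := R_CompleteNormedModule)).
  intros z Hz. rewrite Rmin_left in Hz by lra. apply Hc. lra. }
assert (H0 : forall a b, 0 < a <= b -> 0 <= RInt f a b).
{ intros a b Hab. apply RInt_ge_0; [lra | now apply Hex |].
  intros; apply Hp; lra. }
assert (Hmono : forall a' a b b', 0 < a' <= a -> a <= b <= b' ->
          RInt f a b <= RInt f a' b').
{ intros a' a b b' Ha Hb.
  rewrite <- (RInt_Chasles f a' a b') by (apply Hex; lra).
  rewrite <- (RInt_Chasles f a b b') by (apply Hex; lra).
  unfold plus; simpl.
  generalize (H0 a' a ltac:(lra)) (H0 b b' ltac:(lra)); lra. }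
destruct (completeness (fun v => exists a b, 0 < a <= b /\ v = RInt f a b))
  as [L [HL1 HL2]].
- exists M. intros v (a & b & Hab & ->). now apply HM.
- exists (RInt f 1 1), 1, 1. split; [lra | reflexivity].
- exists L. split.
  2: { intros a b Hab. apply HL1. exists a, b. now split. }
  intros P [eps HP].
  assert (Hab : exists a b, 0 < a <= b /\ L - eps < RInt f a b).
  { apply Classical_Prop.NNPP. intros Hn.
    assert (L <= L - eps); [| destruct eps; simpl in *; lra].
    apply HL2. intros v (a & b & Hab & ->).
    apply Rnot_lt_le. intros Hlt. apply Hn. now exists a, b. }
  destruct Hab as (a0 & b0 & Hab0 & Hlt).
  exists (fun a => 0 < a < a0) (fun b => b0 < b).
  + exists (mkposreal a0 ltac:(lra)). intros y Hy Hy0.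
    apply Rabs_def2 in Hy. unfold minus, plus, opp in Hy; simpl in Hy. lra.
  + exists b0. tauto.
  + intros a b Ha Hb. exists (RInt f a b). split.
    * apply (RInt_correct (V := R_CompleteNormedModule)), Hex. simpl. lra.
    * apply HP. apply Rabs_def1; unfold minus, plus, opp; simpl.
      -- assert (RInt f a b <= L) by (apply HL1; exists a, b; split; [lra | easy]).
         destruct eps; simpl in *; lra.
      -- generalize (Hmono a a0 b0 b ltac:(lra) ltac:(lra)). lra.
Qed.

Lemma ln_le_sub_1 (u : R) : 0 < u -> ln u <= u - 1.
Proof.
intros Hu. generalize (exp_ineq1_le (ln u)). rewrite exp_ln by assumption. lra.
Qed.

(** Half of the exponential decay absorbs the power: ln(t s) <= t s - 1 gives y ln t <= y s t - y (1
    + ln s), and a small s makes y s <= 1/2. *)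
Lemma Rpower_exp_bound (y : R) : 0 <= y ->
  exists K, 0 < K /\
    forall t, 0 < t -> Rpower t y * exp (- t) <= K * exp (- (t / 2)).
Proof.
(* Using y + 1 instead of y keeps [s] meaningful at y = 0. *)
intros Hy. set (s := / (2 * (y + 1))).
assert (Hs : 0 < s) by (apply Rinv_0_lt_compat; lra).
exists (exp (- y * (1 + ln s))). split; [apply exp_pos |].
intros t Ht. unfold Rpower. rewrite <- 2!exp_plus.
assert (Hl : y * ln t <= - y * (1 + ln s) + t / 2).
{ generalize (ln_le_sub_1 (t * s) ltac:(nra)). rewrite ln_mult by assumption.
  intros Hl.
  assert (y * (ln t + ln s) <= y * (t * s - 1)) by (apply Rmult_le_compat_l; lra).
  assert (y * s <= / 2).
  { replace (/ 2) with ((y + 1) * s) by (unfold s; field; lra). nra. }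
  nra. }
destruct (Rle_lt_or_eq_dec (y * ln t + - t) (- y * (1 + ln s) + - (t / 2)))
  as [H | H]; [lra | | rewrite H; apply Rle_refl].
left. now apply exp_increasing.
Qed.

Lemma continuous_Gamma_integrand (y t : R) : 0 < t ->
  continuous (fun t => Rpower t y * exp (- t)) t.
Proof.
intros Ht. apply (ex_derive_continuous (K := R_AbsRing) (V := R_NormedModule)).
unfold Rpower. auto_derive. lra.
Qed.

(** Since x >= 1, the power t^(x-1) stays bounded near 0, so the single majorant K exp(-t/2), of
    integral at most 2 K, gives convergence on the whole half-line. *)
Lemma is_RInt_gen_Gamma (x : R) : 1 <= x ->
  is_RInt_gen (fun t => Rpower t (x - 1) * exp (- t))
    (at_right 0) (Rbar_locally p_infty) (Gamma x) /\ 0 < Gamma x.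
Proof.
intros Hx. set (f := fun t => Rpower t (x - 1) * exp (- t)).
assert (Hpos : forall t, 0 < f t)
  by (intros t; apply Rmult_lt_0_compat; apply exp_pos).
destruct (Rpower_exp_bound (x - 1) ltac:(lra)) as (K & HK & HKf).
assert (Hc : forall t, 0 < t -> continuous f t)
  by (intros; now apply continuous_Gamma_integrand).
destruct (RInt_gen_nonneg_bounded f (2 * K)) as (L & HL & HLb).
- exact Hc.
- intros t _. now left.
- intros a b Hab.
  assert (HI : is_RInt (fun t => K * exp (- (t / 2))) a b
                 (minus (- (2 * K) * exp (- (b / 2))) (- (2 * K) * exp (- (a / 2))))).
  { apply (is_RInt_derive (fun t => - (2 * K) * exp (- (t / 2)))).
    - intros t _. auto_derive; [easy | unfold Rdiv; field].
    - intros t _.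
      apply (ex_derive_continuous (K := R_AbsRing) (V := R_NormedModule)).
      auto_derive. easy. }
  apply Rle_trans with (RInt (fun t => K * exp (- (t / 2))) a b).
  + apply RInt_le; [lra | | eexists; exact HI |].
    * apply (ex_RInt_continuous (V := R_CompleteNormedModule)).
      intros z Hz. rewrite Rmin_left in Hz by lra. apply Hc. lra.
    * intros t Ht. apply HKf. lra.
  + rewrite (is_RInt_unique _ _ _ _ HI). unfold minus, plus, opp; simpl.
    assert (exp (- (a / 2)) <= 1).
    { rewrite <- exp_0. left. apply exp_increasing. lra. }
    generalize (exp_pos (- (b / 2))). nra.
- assert (HG : Gamma x = L) by (apply (is_RInt_gen_unique _ _ HL)).
  rewrite HG. split; [exact HL |].
  (* Positivity is already visible on the compact interval [1, 2]. *)
  apply Rlt_le_trans with (RInt f 1 2); [| apply HLb; lra].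
  apply RInt_gt_0; [lra | intros; apply Hpos |].
  intros t Ht. apply Hc. lra.
Qed.

(** * Integration by parts and the functional equation of Gamma *)

Lemma at_right_Rpower_exp_0 (x : R) : 0 < x ->
  filterlim (fun t => Rpower t x * exp (- t)) (at_right 0) (locally 0).
Proof.
intros Hx P [eps HP].
(* [d] solves d^x = eps. *)
set (d := exp (ln eps / x)).
exists (mkposreal d (exp_pos _)). intros t Ht Ht0.
apply Rabs_def2 in Ht. unfold minus, plus, opp in Ht; simpl in Ht.
apply HP. apply Rabs_def1; unfold minus, plus, opp; simpl.
- assert (Hl : x * ln t < ln eps).
  { replace (ln eps) with (x * (ln eps / x)) by (field; lra).
    apply Rmult_lt_compat_l; [easy |].
    rewrite <- (ln_exp (ln eps / x)). apply ln_increasing; [easy |].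
    fold d. lra. }
  apply exp_increasing in Hl. rewrite exp_ln in Hl by apply cond_pos.
  assert (exp (- t) < 1) by (rewrite <- exp_0; apply exp_increasing; lra).
  unfold Rpower. generalize (exp_pos (x * ln t)) (exp_pos (- t)). nra.
- generalize (exp_pos (x * ln t)) (exp_pos (- t)) (cond_pos eps).
  unfold Rpower. nra.
Qed.

Lemma p_infty_Rpower_exp_0 (x : R) : 0 <= x ->
  filterlim (fun t => Rpower t x * exp (- t)) (Rbar_locally p_infty) (locally 0).
Proof.
intros Hx P [eps HP].
destruct (Rpower_exp_bound x Hx) as (K & HK & HKf).
(* Beyond the second argument K exp(-t/2) < eps; the 0 ensures t > 0, where the bound [HKf]
   applies. *)
exists (Rmax 0 (- 2 * ln (eps / K))). intros t Ht.
assert (H0 := Rle_lt_trans _ _ _ (Rmax_l _ _) Ht).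
assert (H1 := Rle_lt_trans _ _ _ (Rmax_r _ _) Ht).
apply HP. apply Rabs_def1; unfold minus, plus, opp; simpl.
- assert (Hl : - (t / 2) < ln (eps / K)) by lra.
  apply exp_increasing in Hl.
  assert (HeK : 0 < eps / K) by (apply Rdiv_lt_0_compat; [apply cond_pos | easy]).
  rewrite exp_ln in Hl by easy.
  apply (Rmult_lt_compat_l K) in Hl; [| easy].
  replace (K * (eps / K)) with (eps : R) in Hl by (field; lra).
  generalize (HKf t H0). lra.
- generalize (exp_pos (x * ln t)) (exp_pos (- t)) (cond_pos eps).
  unfold Rpower. nra.
Qed.

Lemma is_derive_Rpower_exp (x t : R) : 0 < t ->
  is_derive (fun t => Rpower t x * exp (- t)) t
    (x * (Rpower t (x - 1) * exp (- t)) - Rpower t x * exp (- t)).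
Proof.
intros Ht. unfold Rpower. auto_derive; [easy |].
replace ((x - 1) * ln t) with (x * ln t + - ln t) by ring.
rewrite exp_plus, (exp_Ropp (ln t)), exp_ln by easy. field. lra.
Qed.

(** The integral of the derivative of t^x exp(-t) is computed twice: its boundary values vanish, and
    by the product rule it equals x Gamma(x) - Gamma(x+1). *)
Lemma Gamma_succ (x : R) : 1 <= x -> Gamma (x + 1) = x * Gamma x.
Proof.
intros Hx.
set (h := fun t => Rpower t x * exp (- t)).
set (g := fun t => Rpower t (x - 1) * exp (- t)).
assert (Hprod : filter_prod (at_right 0) (Rbar_locally p_infty)
                  (fun ab : R * R => 0 < fst ab <= snd ab)).
{ exists (fun a => 0 < a < 1) (fun b => 1 < b).
  - exists (mkposreal 1 Rlt_0_1). intros y Hy Hy0. apply Rabs_def2 in Hy.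
    unfold minus, plus, opp in Hy; simpl in Hy. lra.
  - exists 1. tauto.
  - intros a b Ha Hb. simpl. lra. }
assert (HD : forall t, 0 < t -> Derive h t = x * g t - h t).
{ intros t Ht. apply is_derive_unique. now apply is_derive_Rpower_exp. }
assert (H1 : is_RInt_gen (Derive h) (at_right 0) (Rbar_locally p_infty) (0 - 0)).
{ apply is_RInt_gen_Derive.
  - revert Hprod. apply filter_imp. intros [a b] Hab t Ht. simpl in *.
    rewrite Rmin_left in Ht by lra.
    eexists. apply is_derive_Rpower_exp. lra.
  - revert Hprod. apply filter_imp. intros [a b] Hab t Ht. simpl in *.
    rewrite Rmin_left in Ht by lra.
    (* The formula for [Derive h] is known only on t > 0, so continuity is transferred inside the
       ball of radius [t]. *)
    apply (continuous_ext_loc _ (fun t => x * g t - h t)).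
    + exists (mkposreal t ltac:(lra)). intros y Hy. symmetry. apply HD.
      apply Rabs_def2 in Hy. unfold minus, plus, opp in Hy; simpl in Hy. lra.
    + apply (ex_derive_continuous (K := R_AbsRing) (V := R_NormedModule)).
      unfold g, h, Rpower. auto_derive. lra.
  - apply at_right_Rpower_exp_0. lra.
  - apply p_infty_Rpower_exp_0. lra. }
destruct (is_RInt_gen_Gamma x Hx) as [Hgx _].
destruct (is_RInt_gen_Gamma (x + 1) ltac:(lra)) as [Hgx1 _].
replace (x + 1 - 1) with x in Hgx1 by ring.
assert (H2 : is_RInt_gen (Derive h) (at_right 0) (Rbar_locally p_infty)
               (minus (scal x (Gamma x)) (Gamma (x + 1)))).
{ refine (is_RInt_gen_ext _ _ _ _
            (is_RInt_gen_minus _ _ _ _ (is_RInt_gen_scal _ x _ Hgx) Hgx1)).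
  revert Hprod. apply filter_imp. intros [a b] Hab t Ht. simpl in *.
  rewrite Rmin_left in Ht by lra. symmetry. apply HD. lra. }
assert (H3 := eq_trans (eq_sym (is_RInt_gen_unique _ _ H1)) (is_RInt_gen_unique _ _ H2)).
unfold minus, plus, opp, scal in H3; simpl in H3; unfold mult in H3; simpl in H3.
lra.
Qed.

Lemma Gamma_1 : Gamma 1 = 1.
Proof.
apply is_RInt_gen_unique.
assert (H : is_RInt_gen (Derive (fun t => - exp (- t)))
              (at_right 0) (Rbar_locally p_infty) (0 - - exp (- 0))).
{ assert (Hc : forall t, continuous (fun t => - exp (- t)) t).
  { intros t. apply (ex_derive_continuous (K := R_AbsRing) (V := R_NormedModule)).
    auto_derive. easy. }
  apply is_RInt_gen_Derive.
  - apply filter_forall. intros ab t _. auto_derive. easy.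
  - apply filter_forall. intros ab t _.
    apply (continuous_ext (fun t => exp (- t))).
    + intros y. symmetry. apply is_derive_unique. auto_derive; [easy | ring].
    + apply (ex_derive_continuous (K := R_AbsRing) (V := R_NormedModule)).
      auto_derive. easy.
  - eapply filterlim_filter_le_1; [| apply (Hc 0)]. apply filter_le_within.
  - replace 0 with (- 0) by ring.
    apply (filterlim_comp _ _ _ (fun t => exp (- t)) Ropp _ (locally 0)).
    (* Inserting the trivial factor t^0 reduces the limit to the lemma for powers. *)
    + apply (filterlim_ext (fun t => Rpower t 0 * exp (- t))).
      * intros t. unfold Rpower. rewrite Rmult_0_l, exp_0. ring.
      * apply p_infty_Rpower_exp_0. lra.
    + apply (filterlim_opp (V := R_NormedModule)). }
replace (0 - - exp (- 0)) with 1 in H by (rewrite Ropp_0, exp_0; ring).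
revert H. apply is_RInt_gen_ext.
apply filter_forall. intros ab t _.
replace (1 - 1) with 0 by ring. unfold Rpower. rewrite Rmult_0_l, exp_0.
apply is_derive_unique. auto_derive; [easy | ring].
Qed.

(** * The coefficients of the fractional derivative *)

Lemma frac_coef_pos (alpha : R) (n : nat) : 0 < alpha < 1 -> (1 <= n)%nat ->
  0 < frac_coef alpha n.
Proof.
intros Ha Hn. apply (le_INR 1) in Hn. simpl in Hn.
apply Rdiv_lt_0_compat; apply is_RInt_gen_Gamma; lra.
Qed.

Lemma frac_coef_1 (alpha : R) : frac_coef alpha 1 = / Gamma (2 - alpha).
Proof.
unfold frac_coef. change (INR 1) with 1.
rewrite Gamma_succ, Gamma_1 by lra.
replace (1 + 1 - alpha) with (2 - alpha) by ring. unfold Rdiv. ring.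
Qed.

(** The functional equation is applied to numerator and denominator. This explicit ratio yields both
    the monotonicity of the coefficients and their radius of convergence. *)
Lemma frac_coef_succ (alpha : R) (n : nat) : 0 < alpha < 1 -> (1 <= n)%nat ->
  frac_coef alpha (S n) =
  frac_coef alpha n * ((INR n + 1) / (INR n + 1 - alpha)).
Proof.
intros Ha Hn. apply (le_INR 1) in Hn. simpl in Hn.
unfold frac_coef. rewrite S_INR.
replace (INR n + 1 + 1 - alpha) with (INR n + 1 - alpha + 1) by ring.
rewrite (Gamma_succ (INR n + 1)), (Gamma_succ (INR n + 1 - alpha)) by lra.
destruct (is_RInt_gen_Gamma (INR n + 1 - alpha) ltac:(lra)) as [_ HG].
field. lra.
Qed.
(** * Coefficients of bounded power series *)

(* [ring] and [field] reject an equation whose type is a Coquelicot structure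
   over [T] rather than [T] itself. *)
Ltac at_type T := match goal with |- ?x = ?y => change (x = y :> T) end.

Lemma unit_phase (z : C) :
  exists u : C, Cmod u = 1 /\ (u * z)%C = RtoC (Cmod z).
Proof.
destruct (Ceq_dec z 0) as [-> | Hz].
- exists (RtoC 1). rewrite Cmod_1, Cmod_0. split; [easy | ring].
- assert (Hm : 0 < Cmod z) by now apply Cmod_gt_0.
  assert (Hm' : RtoC (Cmod z) <> 0) by (intros H; injection H; lra).
  exists (Cconj z / RtoC (Cmod z))%C. split.
  + rewrite Cmod_div by easy. rewrite Cmod_conj, Cmod_R, Rabs_pos_eq by lra.
    field. lra.
  + replace (Cconj z / RtoC (Cmod z) * z)%C with (z * Cconj z / RtoC (Cmod z))%C
      by (field; easy).
    rewrite <- Cmod2_conj, RtoC_pow. field. easy.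
Qed.

(** * Fourier orthogonality on the circle *)

Definition cis (t : R) : C := (cos t, sin t).

Lemma Cmod_cis (t : R) : Cmod (cis t) = 1.
Proof.
unfold Cmod, cis; simpl fst; simpl snd.
replace (cos t ^ 2 + sin t ^ 2) with 1; [apply sqrt_1 |].
generalize (sin2_cos2 t). unfold Rsqr. lra.
Qed.

Lemma cis_plus (s t : R) : cis (s + t) = (cis s * cis t)%C.
Proof.
unfold cis, Cmult; simpl. rewrite cos_plus, sin_plus. f_equal; ring.
Qed.

Lemma pow_n_polar (r t : R) (k : nat) :
  pow_n (K := C_AbsRing) (RtoC r * cis t)%C k = (RtoC (r ^ k) * cis (INR k * t))%C :> C.
Proof.
induction k as [| k IH].
- simpl. rewrite Rmult_0_l. unfold cis. rewrite cos_0, sin_0.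
  change (RtoC 1 = RtoC 1 * RtoC 1)%C. ring.
- change (pow_n (K := C_AbsRing) (RtoC r * cis t)%C (S k))
    with ((RtoC r * cis t) * pow_n (K := C_AbsRing) (RtoC r * cis t)%C k)%C.
  rewrite IH, S_INR, Rmult_plus_distr_r, cis_plus, Rmult_1_l.
  change (r ^ S k) with (r * r ^ k). rewrite RtoC_mult. ring.
Qed.

(** A nonzero frequency has a periodic primitive and integrates to 0 over a full turn. The frequency
    is in [Z] because differences of frequencies occur below. *)
Lemma is_RInt_Re_cis (c : C) (p : Z) :
  is_RInt (fun t => Re (c * cis (IZR p * t))%C) 0 (2 * PI)
    (if Z.eq_dec p 0 then 2 * PI * Re c else 0).
Proof.
destruct c as [c1 c2].
apply (is_RInt_ext (fun t => c1 * cos (IZR p * t) - c2 * sin (IZR p * t))).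
{ intros t _. reflexivity. }
destruct (Z.eq_dec p 0) as [-> | Hp].
- apply (is_RInt_ext (fun _ => c1)).
  { intros t _. rewrite Rmult_0_l, cos_0, sin_0. at_type R. ring. }
  replace (2 * PI * Re (c1, c2)) with (scal (2 * PI - 0) c1).
  + apply (is_RInt_const (V := R_NormedModule)).
  + unfold scal; simpl; unfold mult; simpl. ring.
- apply not_0_IZR in Hp.
  assert (Hs : sin (IZR p * PI) = 0) by (apply sin_eq_0_1; now exists p).
  set (F := fun t => (c1 * sin (IZR p * t) + c2 * cos (IZR p * t)) / IZR p).
  (* The second 0 is the value of the integral; the first is the lower endpoint. *)
  replace 0 with (minus (F (2 * PI)) (F 0)) at 2.
  + apply (is_RInt_derive F).
    * intros t _. unfold F. auto_derive; [easy | field; easy].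
    * intros t _.
      apply (ex_derive_continuous (K := R_AbsRing) (V := R_NormedModule)).
      auto_derive. easy.
  + unfold F, minus, plus, opp; simpl.
    replace (IZR p * (2 * PI)) with (2 * (IZR p * PI)) by ring.
    rewrite sin_2a, cos_2a_sin, Hs, !Rmult_0_r, sin_0, cos_0. at_type R. field. easy.
Qed.

Lemma Re_mult_Re (z w : C) :
  Re z * Re w = / 2 * Re (z * w)%C + / 2 * Re (z * Cconj w)%C.
Proof. destruct z, w. simpl. field. Qed.

Lemma Cconj_cis (t : R) : Cconj (cis t) = cis (- t).
Proof. unfold cis, Cconj; simpl. now rewrite cos_neg, sin_neg. Qed.

(** By the product-to-sum identity [Re_mult_Re], the integrand splits into the frequencies m, m + n
    and m - n, each of which contributes only when it is zero. *)
Lemma is_RInt_Re_cis_kernel (c d : C) (m n : Z) :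
  is_RInt (fun t => Re (c * cis (IZR m * t))%C * (1 + Re (d * cis (IZR n * t))%C))
    0 (2 * PI)
    ((if Z.eq_dec m 0 then 2 * PI * Re c else 0) +
     (/ 2 * (if Z.eq_dec (m + n) 0 then 2 * PI * Re (c * d)%C else 0) +
      / 2 * (if Z.eq_dec (m - n) 0 then 2 * PI * Re (c * Cconj d)%C else 0))).
Proof.
refine (is_RInt_ext _ _ _ _ _ _
  (is_RInt_plus _ _ _ _ _ _ (is_RInt_Re_cis c m)
    (is_RInt_plus _ _ _ _ _ _
      (is_RInt_scal _ _ _ (/ 2) _ (is_RInt_Re_cis (c * d)%C (m + n)))
      (is_RInt_scal _ _ _ (/ 2) _ (is_RInt_Re_cis (c * Cconj d)%C (m - n)))))).
intros t _. symmetry.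
rewrite Rmult_plus_distr_l, Rmult_1_r, Re_mult_Re, Cmult_conj, Cconj_cis.
rewrite plus_IZR, minus_IZR, Rmult_plus_distr_r, cis_plus.
replace ((IZR m - IZR n) * t) with (IZR m * t + - (IZR n * t)) by ring.
rewrite cis_plus.
replace (c * cis (IZR m * t) * (d * cis (IZR n * t)))%C
  with (c * d * (cis (IZR m * t) * cis (IZR n * t)))%C by ring.
replace (c * cis (IZR m * t) * (Cconj d * cis (- (IZR n * t))))%C
  with (c * Cconj d * (cis (IZR m * t) * cis (- (IZR n * t))))%C by ring.
reflexivity.
Qed.

Lemma sum_n_delta (j M : nat) (x : R) : (j <= M)%nat ->
  sum_n (fun k => if Nat.eq_dec k j then x else 0) M = x.
Proof.
intros HjM. induction M as [| M IH].
- rewrite sum_O. destruct (Nat.eq_dec 0 j); [easy | lia].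
- rewrite sum_Sn. change plus with Rplus. at_type R.
  destruct (Nat.eq_dec (S M) j) as [<- | Hne].
  + rewrite (sum_n_ext_loc _ (fun _ => 0)).
    * rewrite sum_n_const. ring.
    * intros k Hk. destruct (Nat.eq_dec k (S M)); [lia | easy].
  + rewrite IH by lia. ring.
Qed.

Lemma Re_mult_sum_n (w : C) (g : nat -> C) (M : nat) :
  Re (w * sum_n (G := C_AbelianMonoid) g M)%C = sum_n (fun k => Re (w * g k)%C) M.
Proof.
induction M as [| M IH].
- now rewrite 2!sum_O.
- rewrite 2!sum_Sn, <- IH. at_type R. unfold plus; simpl. ring.
Qed.

Lemma is_RInt_sum_n (g : nat -> R -> R) (v : nat -> R) (a b : R) (M : nat) :
  (forall k, is_RInt (g k) a b (v k)) ->
  is_RInt (fun t => sum_n (fun k => g k t) M) a b (sum_n v M).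
Proof.
intros Hg. induction M as [| M IH].
- rewrite sum_O. apply (is_RInt_ext (g 0%nat)); [| easy].
  intros t _. now rewrite sum_O.
- rewrite sum_Sn.
  apply (is_RInt_ext (fun t => plus (sum_n (fun k => g k t) M) (g (S M) t))).
  + intros t _. now rewrite sum_Sn.
  + now apply (is_RInt_plus (V := R_NormedModule)).
Qed.

(* Integrate [Re (u exp(-it) P(t))] against the nonnegative kernel
   [1 + Re (d exp(int))], where the unimodular [u] and [d] rotate both surviving
   coefficients to the positive axis. *)
Lemma trig_poly_coef_bound (c : nat -> C) (M n : nat) (B : R) :
  c 0%nat = RtoC 0 -> (1 <= n)%nat -> (S n <= M)%nat ->
  (forall t, Cmod (sum_n (G := C_AbelianMonoid)
                     (fun k => c k * cis (INR k * t))%C M) <= B) ->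
  Cmod (c 1%nat) + Cmod (c (S n)) / 2 <= B.
Proof.
intros Hc0 Hn HM HB.
destruct (unit_phase (c 1%nat)) as (u & Hu & Huc).
destruct (unit_phase (u * c (S n))%C) as (e & He & Hec).
(* The surviving term at frequency m - n = 0 involves the conjugate of [d], which is then [e]. *)
set (d := Cconj e).
assert (Hd : Cmod d = 1) by (unfold d; now rewrite Cmod_conj).
set (K := fun t => 1 + Re (d * cis (IZR (Z.of_nat n) * t))%C).
assert (HK : forall t, 0 <= K t).
{ intros t. unfold K.
  generalize (re_le_Cmod (d * cis (IZR (Z.of_nat n) * t))%C).
  rewrite Cmod_mult, Hd, Cmod_cis. intros H. apply Rabs_le_between in H. lra. }
(* After the twist by exp(-it), k = 1 has frequency 0 and meets the constant 1 of the kernel, while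
   k = n + 1 has frequency n and meets its cosine part, with half the weight. *)
set (v := fun k =>
  (if Nat.eq_dec k 1 then 2 * PI * Cmod (c 1%nat) else 0) +
  (if Nat.eq_dec k (S n) then PI * Cmod (c (S n)) else 0)).
assert (HI : is_RInt (fun t => sum_n (fun k =>
                Re (u * c k * cis (IZR (Z.of_nat k - 1) * t))%C * K t) M)
               0 (2 * PI) (sum_n v M)).
{ apply is_RInt_sum_n. intros k.
  generalize (is_RInt_Re_cis_kernel (u * c k)%C d (Z.of_nat k - 1) (Z.of_nat n)).
  match goal with |- is_RInt _ _ _ ?x -> _ => replace x with (v k); [easy |] end.
  unfold v.
  (* The sum frequency k - 1 + n vanishes only for k = 0 and n = 1, where the coefficient [c 0] is
     zero. *)
  replace (/ 2 * (if Z.eq_dec (Z.of_nat k - 1 + Z.of_nat n) 0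
                  then 2 * PI * Re (u * c k * d)%C else 0)) with 0.
  2: { destruct (Z.eq_dec (Z.of_nat k - 1 + Z.of_nat n) 0) as [H |]; [| ring].
       replace k with 0%nat by lia. rewrite Hc0.
       replace (u * 0 * d)%C with (RtoC 0) by ring. simpl. ring. }
  f_equal.
  - destruct (Nat.eq_dec k 1) as [-> | H1];
      destruct (Z.eq_dec _ 0) as [H2 | H2]; try lia; [| easy].
    now rewrite Huc.
  - destruct (Nat.eq_dec k (S n)) as [-> | H1];
      destruct (Z.eq_dec _ 0) as [H2 | H2]; try lia; [| ring].
    unfold d. rewrite Cconj_conj, Cmult_comm, Hec, Cmod_mult, Hu. simpl. field. }
(* The kernel has total mass 2 pi: its oscillating part has frequency n >= 1. *)
assert (HIB : is_RInt (fun t => B * K t) 0 (2 * PI) (2 * PI * B)).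
{ generalize (is_RInt_Re_cis_kernel (RtoC B) d 0 (Z.of_nat n)).
  destruct (Z.eq_dec 0 0); [| easy].
  destruct (Z.eq_dec (0 + Z.of_nat n) 0); [lia |].
  destruct (Z.eq_dec (0 - Z.of_nat n) 0); [lia |].
  match goal with |- is_RInt _ _ _ ?x -> _ => replace x with (2 * PI * B) end.
  2: { simpl. ring. }
  apply is_RInt_ext. intros t _. fold (K t).
  rewrite Rmult_0_l. simpl. rewrite cos_0, sin_0. ring. }
assert (Hv : sum_n v M = 2 * PI * Cmod (c 1%nat) + PI * Cmod (c (S n))).
{ unfold v. rewrite (sum_n_plus (G := R_AbelianMonoid)).
  rewrite 2!sum_n_delta by lia. easy. }
assert (Hle : sum_n v M <= 2 * PI * B).
{ refine (is_RInt_le _ _ _ _ _ _ _ HI HIB _).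
  - generalize PI_RGT_0. lra.
  - intros t _.
    rewrite (sum_n_mult_r (K := R_Ring)). change mult with Rmult.
    apply Rmult_le_compat_r; [apply HK |].
    rewrite (sum_n_ext _ (fun k => Re (u * cis (- t) * (c k * cis (INR k * t)))%C)).
    + rewrite <- Re_mult_sum_n.
      eapply Rle_trans; [apply Rle_abs |].
      eapply Rle_trans; [apply re_le_Cmod |].
      rewrite 2!Cmod_mult, Hu, Cmod_cis, 2!Rmult_1_l. apply HB.
    + intros k. f_equal. rewrite minus_IZR, <- INR_IZR_INZ.
      replace ((INR k - 1) * t) with (- t + INR k * t) by ring.
      rewrite cis_plus. ring. }
rewrite Hv in Hle. generalize PI_RGT_0. intros HPI.
apply (Rmult_le_reg_l (2 * PI)); lra.
Qed.

(** * From trigonometric polynomials to power series *)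

Lemma is_series_norm_le (a : nat -> C) (b : nat -> R) (l : C) (s : R) :
  is_series (V := C_NormedModule) a l -> is_series b s ->
  (forall n, Cmod (a n) <= b n) -> Cmod l <= s.
Proof.
intros Ha Hb Hab.
refine (filterlim_le (F := eventually)
  (fun n => norm (sum_n (G := C_NormedModule) a n)) (sum_n b) (norm (l : C_NormedModule)) s _ _ Hb).
- apply filter_forall. intros n.
  eapply Rle_trans; [apply (norm_sum_n_m a 0 n) |].
  apply sum_n_m_le. exact Hab.
- apply (filterlim_comp _ _ _ (sum_n a) norm _ (locally l)); [exact Ha |].
  apply (filterlim_norm (V := C_NormedModule)).
Qed.

(** Each term is a difference of consecutive partial sums, which are bounded because they
    converge. *)
Lemma is_series_terms_bounded (a : nat -> C) (l : C) :
  is_series (V := C_NormedModule) a l ->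
  exists K, 0 < K /\ forall n, Cmod (a n) <= K.
Proof.
intros Ha.
destruct (filterlim_bounded (V := C_NormedModule) (sum_n a) (ex_intro _ l Ha))
  as [B HB].
assert (HB' : forall n, Cmod (sum_n (G := C_NormedModule) a n) <= B)
  by exact HB.
assert (HB0 : 0 <= B) by (eapply Rle_trans; [apply Cmod_ge_0 | apply (HB' 0%nat)]).
exists (2 * B + 1). split; [lra |]. intros [| n].
- generalize (HB' 0%nat). rewrite sum_O. lra.
- replace (a (S n)) with (sum_n (G := C_NormedModule) a (S n)
                          + - sum_n (G := C_NormedModule) a n)%C.
  + eapply Rle_trans; [apply Cmod_triangle |]. rewrite Cmod_opp.
    generalize (HB' n) (HB' (S n)). lra.
  + rewrite sum_Sn.
    change (sum_n a n + a (S n) + - sum_n a n = a (S n))%C. ring.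
Qed.

(** On the circle of radius [r] the Taylor polynomial of degree M is bounded by 1 plus a geometric
    tail. The bound for trigonometric polynomials applies to it, and the tail disappears as M tends
    to infinity. *)
Lemma class_B_coef_bound_radius (f : C -> C) (a : nat -> C) (n : nat) (r : R) :
  (forall z, in_disk z -> Cmod (f z) < 1) -> power_series_from_1 f a ->
  (1 <= n)%nat -> 0 < r < 1 ->
  Cmod (a 1%nat) * r + Cmod (a (S n)) * r ^ S n / 2 <= 1.
Proof.
intros Hf [Ha0 Ha] Hn Hr.
(* Convergence at the larger radius [s] bounds |a_k| s^k, so the terms at radius [r] decay like
   q^k. *)
set (s := (1 + r) / 2). set (q := r / s).
assert (Hs : r < s < 1) by (unfold s; lra).
assert (Hq : 0 < q < 1).
{ unfold q. split; [apply Rdiv_lt_0_compat; lra |].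
  apply (Rmult_lt_reg_r s); [lra |]. unfold Rdiv. rewrite Rmult_assoc, Rinv_l; lra. }
assert (Hgeom : is_series (fun n => q ^ n) (/ (1 - q)))
  by (apply is_series_geom; rewrite Rabs_pos_eq; lra).
assert (Hmod : forall x t k, 0 < x ->
  Cmod (pow_n (K := C_AbsRing) (RtoC x * cis t)%C k * a k)%C = Cmod (a k) * x ^ k).
{ intros x t k Hx. rewrite pow_n_polar, 2!Cmod_mult, Cmod_cis, Cmod_R, Rabs_pos_eq.
  - ring.
  - apply pow_le. lra. }
assert (Hdisk : forall x t, 0 < x < 1 -> in_disk (RtoC x * cis t)%C).
{ intros x t Hx. unfold in_disk. rewrite Cmod_mult, Cmod_cis, Cmod_R, Rabs_pos_eq; lra. }
destruct (is_series_terms_bounded _ _ (Ha _ (Hdisk s 0 ltac:(lra)))) as (K & HK & HKa).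
assert (Hak : forall k, Cmod (a k) * r ^ k <= K * q ^ k).
{ intros k. generalize (HKa k). change (@scal _ C_NormedModule) with Cmult.
  rewrite Hmod by lra. intros Hk.
  replace (r ^ k) with (s ^ k * q ^ k).
  - rewrite <- Rmult_assoc. apply Rmult_le_compat_r; [apply pow_le; lra | easy].
  - rewrite <- Rpow_mult_distr. f_equal. unfold q. field. lra. }
assert (Hbound : forall M, (S n <= M)%nat ->
  Cmod (a 1%nat) * r + Cmod (a (S n)) * r ^ S n / 2
    <= 1 + K * q ^ S M * / (1 - q)).
{ intros M HM.
  generalize (trig_poly_coef_bound (fun k => a k * RtoC (r ^ k))%C M n
                (1 + K * q ^ S M * / (1 - q))).
  rewrite 2!Cmod_mult, 2!Cmod_R, 2!Rabs_pos_eq, pow_1 by (apply pow_le; lra).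
  intros H. apply H; [rewrite Ha0; ring | easy | easy |].
  intros t. set (z := (RtoC r * cis t)%C).
  set (g := fun k => (pow_n (K := C_AbsRing) z k * a k)%C).
  rewrite (sum_n_ext (G := C_AbelianMonoid) _ g).
  2: { intros k. unfold g, z. rewrite pow_n_polar. at_type C. ring. }
  assert (Htail : is_series (V := C_NormedModule) (fun k => g (S M + k)%nat)
                    (f z - sum_n (G := C_AbelianMonoid) g M)%C).
  { apply (is_series_incr_n (V := C_NormedModule) g (S M)); [lia |].
    simpl pred.
    replace (plus _ _) with (f z).
    - apply Ha, Hdisk. easy.
    - change (f z = f z - sum_n (G := C_AbelianMonoid) g M
                    + sum_n (G := C_AbelianMonoid) g M)%C. ring. }
  assert (Hle : Cmod (f z - sum_n (G := C_AbelianMonoid) g M)%C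
                <= K * q ^ S M * / (1 - q)).
  { apply (is_series_norm_le _ (fun k => K * q ^ S M * q ^ k) _ _ Htail).
    - apply (is_series_scal (V := R_NormedModule)), Hgeom.
    - intros k. unfold g, z. rewrite Hmod by lra.
      rewrite Rmult_assoc, <- pow_add. apply Hak. }
  (* The polynomial is [f z] minus the tail, and |f(z)| < 1. *)
  replace (sum_n (G := C_AbelianMonoid) g M)
    with (f z + - (f z - sum_n (G := C_AbelianMonoid) g M))%C by ring.
  eapply Rle_trans; [apply Cmod_triangle |]. rewrite Cmod_opp.
  generalize (Hf z (Hdisk r t Hr)). lra. }
(* The left side does not depend on M, and the bound holds only from M = n + 1 on. *)
refine (is_lim_seq_le_loc (fun _ => _) (fun M => 1 + K * q ^ S M * / (1 - q))
          _ 1 _ (is_lim_seq_const _) _).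
- exists (S n). exact Hbound.
- replace (Finite 1) with (Finite (1 + K * 0 * / (1 - q))) by (f_equal; ring).
  apply is_lim_seq_plus'; [apply is_lim_seq_const |].
  apply is_lim_seq_mult'; [| apply is_lim_seq_const].
  apply is_lim_seq_mult'; [apply is_lim_seq_const |].
  apply (is_lim_seq_incr_1 (fun M => q ^ M)).
  apply is_lim_seq_geom. rewrite Rabs_pos_eq; lra.
Qed.

(** The radius is sent to 1 in the previous bound, whose left side is a polynomial in it. *)
Lemma class_B_coef_bound (f : C -> C) (a : nat -> C) (n : nat) :
  (forall z, in_disk z -> Cmod (f z) < 1) -> power_series_from_1 f a ->
  (1 <= n)%nat -> Cmod (a 1%nat) + Cmod (a (S n)) / 2 <= 1.
Proof.
intros Hf Ha Hn.
(* The shift by 2 keeps every radius in (0, 1), starting from 1/2. *)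
set (x := fun m : nat => 1 - / (INR m + 2)).
assert (Hx : forall m, 0 < x m < 1).
{ intros m. unfold x. generalize (pos_INR m). intros Hm.
  assert (0 < / (INR m + 2)) by (apply Rinv_0_lt_compat; lra).
  assert (/ (INR m + 2) <= / 2) by (apply Rinv_le_contravar; lra). lra. }
assert (Hlim : is_lim_seq x 1).
{ replace (Finite 1) with (Finite (1 - 0)) by (f_equal; ring).
  apply is_lim_seq_minus'; [apply is_lim_seq_const |].
  apply (is_lim_seq_inv _ p_infty); [| easy].
  eapply is_lim_seq_plus; [apply is_lim_seq_INR | apply is_lim_seq_const | easy]. }
change (Rbar_le (Cmod (a 1%nat) + Cmod (a (S n)) / 2) 1).
refine (is_lim_seq_le
  (fun m => Cmod (a 1%nat) * x m + Cmod (a (S n)) * x m ^ S n / 2) (fun _ => 1)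
  _ 1 _ _ (is_lim_seq_const _)).
- intros m. now apply (class_B_coef_bound_radius f).
- set (p := fun y => Cmod (a 1%nat) * y + Cmod (a (S n)) * y ^ S n / 2).
  replace (Finite (Cmod (a 1%nat) + Cmod (a (S n)) / 2)) with (Finite (p 1))
    by (unfold p; rewrite pow1; f_equal; field).
  apply (is_lim_seq_continuous p); [| exact Hlim].
  apply derivable_continuous_pt, ex_derive_Reals_0. unfold p. auto_derive. easy.
Qed.

(** * The radius *)

Lemma frac_coef_incr (alpha : R) (n : nat) : 0 < alpha < 1 -> (1 <= n)%nat ->
  frac_coef alpha n <= frac_coef alpha (S n).
Proof.
intros Ha Hn. rewrite frac_coef_succ by easy.
generalize (frac_coef_pos alpha n Ha Hn). intros Hc.
apply (le_INR 1) in Hn. simpl in Hn.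
rewrite <- (Rmult_1_r (frac_coef alpha n)) at 1.
apply Rmult_le_compat_l; [lra |].
apply Rle_div_r; lra.
Qed.

Lemma frac_coef_ge_1 (alpha : R) (k : nat) : 0 < alpha < 1 ->
  frac_coef alpha 1 <= frac_coef alpha (S k).
Proof.
intros Ha. induction k as [| k IH]; [apply Rle_refl |].
eapply Rle_trans; [exact IH |]. apply frac_coef_incr; [easy | lia].
Qed.

(** Ratio test: consecutive coefficients have quotient 1 + alpha / (k + 3 - alpha), which tends to
    1. *)
Lemma CV_radius_frac_coef (alpha : R) : 0 < alpha < 1 ->
  CV_radius (fun k => frac_coef alpha (k + 2)) = 1.
Proof.
intros Ha. rewrite <- Rinv_1.
assert (Hpos : forall k, 0 < frac_coef alpha (k + 2))
  by (intros k; apply frac_coef_pos; [easy | lia]).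
apply CV_radius_finite_DAlembert; [| lra |].
- intros k. generalize (Hpos k). lra.
- apply (is_lim_seq_ext (fun k => 1 + alpha * / (INR k + (3 - alpha)))).
  + intros k. simpl (S k + 2)%nat. rewrite frac_coef_succ by (easy || lia).
    generalize (pos_INR k) (Hpos k). rewrite plus_INR. intros Hk Hc. simpl (INR 2).
    replace (frac_coef alpha (k + 2) * ((INR k + (1 + 1) + 1) / (INR k + (1 + 1) + 1 - alpha)) /
             frac_coef alpha (k + 2))
      with (1 + alpha * / (INR k + (3 - alpha))) by (field; lra).
    assert (0 < / (INR k + (3 - alpha))) by (apply Rinv_0_lt_compat; lra).
    rewrite Rabs_pos_eq; nra.
  + replace (Finite 1) with (Finite (1 + alpha * 0)) by (f_equal; ring).
    apply is_lim_seq_plus'; [apply is_lim_seq_const |].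
    apply is_lim_seq_mult'; [apply is_lim_seq_const |].
    apply (is_lim_seq_inv _ p_infty); [| easy].
    eapply is_lim_seq_plus; [apply is_lim_seq_INR | apply is_lim_seq_const | easy].
Qed.

(** Written without a division, so that it vanishes at r = 0, the left end of the interval on which
    the root is sought. *)
Definition frac_tail (alpha r : R) : R :=
  r * PSeries (fun k => frac_coef alpha (k + 2)) r.

Lemma is_pseries_frac_coef (alpha r : R) : 0 < alpha < 1 -> 0 <= r < 1 ->
  is_series (fun k => frac_coef alpha (k + 2) * r ^ k)
    (PSeries (fun k => frac_coef alpha (k + 2)) r).
Proof.
intros Ha Hr.
apply Series_correct, ex_pseries_R, CV_radius_inside.
rewrite CV_radius_frac_coef by easy. simpl. rewrite Rabs_pos_eq; lra.
Qed.

Lemma is_series_frac_tail (alpha r : R) : 0 < alpha < 1 -> 0 <= r < 1 ->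
  is_series (fun k => frac_coef alpha (k + 2) * r ^ (k + 2)) (r * frac_tail alpha r).
Proof.
intros Ha Hr. unfold frac_tail. rewrite <- Rmult_assoc.
apply (is_series_ext (fun k => r * r * (frac_coef alpha (k + 2) * r ^ k))).
- intros k. rewrite pow_add. at_type R. ring.
- apply (is_series_scal (V := R_NormedModule)). now apply is_pseries_frac_coef.
Qed.

Lemma PSeries_frac_coef_incr (alpha r s : R) : 0 < alpha < 1 -> 0 <= r <= s -> s < 1 ->
  PSeries (fun k => frac_coef alpha (k + 2)) r
    <= PSeries (fun k => frac_coef alpha (k + 2)) s.
Proof.
intros Ha Hr Hs. apply Series_le.
- intros k. generalize (frac_coef_pos alpha (k + 2) Ha ltac:(lia)). intros Hc. split.
  + apply Rmult_le_pos; [lra | apply pow_le; lra].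
  + apply Rmult_le_compat_l; [lra | now apply pow_incr].
- eexists. apply is_pseries_frac_coef; lra.
Qed.

(** Every coefficient is at least the first, so a geometric series is a minorant. It supplies both
    strict growth of [frac_tail] and its size at 1/2. *)
Lemma PSeries_frac_coef_ge (alpha r : R) : 0 < alpha < 1 -> 0 <= r < 1 ->
  frac_coef alpha 1 * / (1 - r) <= PSeries (fun k => frac_coef alpha (k + 2)) r.
Proof.
intros Ha Hr. generalize (frac_coef_pos alpha 1 Ha ltac:(lia)). intros Hc.
rewrite <- (Series_geom r), <- Series_scal_l by (rewrite Rabs_pos_eq; lra).
apply Series_le.
- intros k. assert (0 <= r ^ k) by (apply pow_le; lra). split.
  + apply Rmult_le_pos; lra.
  + apply Rmult_le_compat_r; [easy |].
    replace (k + 2)%nat with (S (S k)) by lia. now apply frac_coef_ge_1.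
- eexists. now apply is_pseries_frac_coef.
Qed.

(** Strictness comes from the factor r, multiplied by the positive value of the series at [s]. *)
Lemma frac_tail_incr (alpha r s : R) : 0 < alpha < 1 -> 0 <= r < s -> s < 1 ->
  frac_tail alpha r < frac_tail alpha s.
Proof.
intros Ha Hr Hs. unfold frac_tail.
generalize (PSeries_frac_coef_incr alpha r s Ha ltac:(lra) Hs).
generalize (PSeries_frac_coef_ge alpha s Ha ltac:(lra)).
generalize (frac_coef_pos alpha 1 Ha ltac:(lia)).
assert (0 < / (1 - s)) by (apply Rinv_0_lt_compat; lra).
intros Hc Hge Hincr.
assert (0 < frac_coef alpha 1 * / (1 - s)) by now apply Rmult_lt_0_compat.
apply Rle_lt_trans with (r * PSeries (fun k => frac_coef alpha (k + 2)) s).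
- apply Rmult_le_compat_l; lra.
- apply Rmult_lt_compat_r; lra.
Qed.

(** Both sides of the equation are divided by r, with c_1 = 1 / Gamma(2 - alpha). *)
Lemma radius_equation_iff (alpha r : R) : 0 < alpha < 1 -> 0 < r < 1 ->
  radius_equation alpha r <-> frac_tail alpha r = frac_coef alpha 1 / 2.
Proof.
intros Ha Hr.
assert (HG : 0 < Gamma (2 - alpha)) by (apply is_RInt_gen_Gamma; lra).
generalize (is_series_frac_tail alpha r Ha ltac:(lra)). intros HT.
assert (Heq : r / (2 * Gamma (2 - alpha)) = r * (frac_coef alpha 1 / 2))
  by (rewrite frac_coef_1; field; lra).
unfold radius_equation. rewrite Heq. split.
- intros H. apply is_series_unique in H. apply is_series_unique in HT.
  rewrite H in HT. now apply Rmult_eq_reg_l in HT; [| lra].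
- now intros <-.
Qed.

Lemma frac_tail_solution (alpha : R) : 0 < alpha < 1 ->
  exists rho, 0 < rho < 1 /\ frac_tail alpha rho = frac_coef alpha 1 / 2.
Proof.
intros Ha. generalize (frac_coef_pos alpha 1 Ha ltac:(lia)). intros Hc.
destruct (Ranalysis5.IVT_interv
            (fun r => frac_tail alpha r - frac_coef alpha 1 / 2) 0 (1 / 2))
  as (rho & Hrho & Heq); [| lra | | |].
- intros r Hr. apply continuity_pt_minus; [| apply continuity_pt_const; now intros x y].
  apply continuity_pt_mult; [apply continuity_pt_id |].
  apply PSeries_continuity. rewrite CV_radius_frac_coef by easy.
  simpl. rewrite Rabs_pos_eq; lra.
- unfold frac_tail. lra.
- generalize (PSeries_frac_coef_ge alpha (1 / 2) Ha ltac:(lra)).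
  replace (/ (1 - 1 / 2)) with 2 by field. unfold frac_tail. lra.
- exists rho. split; [| lra].
  (* The intermediate value theorem gives a root in the closed interval; 0 is excluded because the
     function equals -c_1/2 there. *)
  destruct (Req_dec rho 0) as [-> |]; [| lra].
  unfold frac_tail in Heq. lra.
Qed.

Lemma min_positive_solution_frac_tail (alpha rho : R) : 0 < alpha < 1 -> 0 < rho < 1 ->
  frac_tail alpha rho = frac_coef alpha 1 / 2 -> min_positive_solution alpha rho.
Proof.
intros Ha Hrho Heq. split; [split; [easy | now apply radius_equation_iff] |].
intros s Hs Hsol. apply radius_equation_iff in Hsol; [| easy | easy].
apply Rnot_lt_le. intros Hlt.
generalize (frac_tail_incr alpha s rho Ha ltac:(lra) ltac:(lra)). lra.
Qed.

(** * The majorant inequality up to the radius *)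

Theorem theorem3p2 (alpha : R) (halpha : 0 < alpha < 1) :
  exists rho : R,
    min_positive_solution alpha rho /\
    forall (f : C -> C) (a : nat -> C),
      class_B f ->
      power_series_from_1 f a ->
      forall r : R, 0 < r <= rho ->
        ex_series (fun k : nat => bohr_term alpha a r (k + 1)) /\
        Series (fun k : nat => bohr_term alpha a r (k + 1))
          <= Rpower r (1 - alpha) / Gamma (2 - alpha).
Proof.
destruct (frac_tail_solution alpha halpha) as (rho & Hrho & Heq).
exists rho. split; [now apply min_positive_solution_frac_tail |].
intros f a [_ Hf] Ha r Hr.
assert (Hcoef : forall n, (1 <= n)%nat -> Cmod (a (S n)) <= 2 * (1 - Cmod (a 1%nat))).
{ intros n Hn. generalize (class_B_coef_bound f a n Hf Ha Hn). lra. }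
assert (Ha1 : 0 <= 1 - Cmod (a 1%nat)).
{ generalize (Hcoef 1%nat ltac:(lia)) (Cmod_ge_0 (a 2%nat)). lra. }
assert (Hpow : forall n, Rpower r (INR n - alpha) = r ^ n * Rpower r (- alpha)).
{ intros n. unfold Rminus. rewrite Rpower_plus, Rpower_pow; [easy | lra]. }
set (w := Rpower r (- alpha)).
assert (Hw : 0 < w) by apply exp_pos.
assert (Hc1 := frac_coef_pos alpha 1 halpha ltac:(lia)).
assert (HT : frac_tail alpha r <= frac_coef alpha 1 / 2).
{ destruct (Rle_lt_or_eq_dec r rho ltac:(lra)) as [Hlt | ->]; [| lra].
  generalize (frac_tail_incr alpha r rho halpha ltac:(lra) ltac:(lra)). lra. }
(* The majorant keeps the term n = 1 exact and replaces |a_n| by 2 (1 - |a_1|) for n >= 2. Index k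
   stands for n = k + 1, hence [j + 2] in the successor case. *)
set (b := fun k => match k with
  | O => bohr_term alpha a r 1
  | S j => 2 * (1 - Cmod (a 1%nat)) * w * (frac_coef alpha (j + 2) * r ^ (j + 2))
  end).
assert (Hb : is_series b (bohr_term alpha a r 1
               + 2 * (1 - Cmod (a 1%nat)) * w * (r * frac_tail alpha r))).
{ apply is_series_decr_1. simpl b.
  replace (plus _ _) with (2 * (1 - Cmod (a 1%nat)) * w * (r * frac_tail alpha r))
    by (unfold plus, opp; simpl; ring).
  apply (is_series_scal (V := R_NormedModule)). apply is_series_frac_tail; lra. }
assert (Hle : forall k, 0 <= bohr_term alpha a r (k + 1) <= b k).
{ intros k.
  assert (Hc := frac_coef_pos alpha (k + 1) halpha ltac:(lia)).
  split.
  - apply Rmult_le_pos; [| left; apply exp_pos].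
    apply Rmult_le_pos; [lra | apply Cmod_ge_0].
  - destruct k as [| k]; [apply Rle_refl |].
    replace (S k + 1)%nat with (k + 2)%nat in * by lia. simpl b.
    unfold bohr_term. rewrite Hpow. fold w.
    assert (0 <= r ^ (k + 2)) by (apply pow_le; lra).
    replace (frac_coef alpha (k + 2) * Cmod (a (k + 2)%nat) * (r ^ (k + 2) * w))
      with (Cmod (a (k + 2)%nat) * (w * (frac_coef alpha (k + 2) * r ^ (k + 2)))) by ring.
    rewrite (Rmult_assoc (2 * _)).
    apply Rmult_le_compat_r.
    + apply Rmult_le_pos; [lra | apply Rmult_le_pos; lra].
    + replace (k + 2)%nat with (S (k + 1)) by lia. apply Hcoef. lia. }
split.
- apply (ex_series_le (V := R_CompleteNormedModule) _ b); [| eexists; exact Hb].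
  intros k. change norm with Rabs. rewrite Rabs_pos_eq; apply Hle.
- apply Rle_trans with (Series b); [apply Series_le; [exact Hle | eexists; exact Hb] |].
  rewrite (is_series_unique _ _ Hb). unfold bohr_term.
  assert (Hp1 := Hpow 1%nat). rewrite pow_1 in Hp1. change (INR 1) with 1 in *.
  unfold Rdiv. rewrite <- frac_coef_1, Hp1. fold w.
  assert (0 < w * r) by (apply Rmult_lt_0_compat; lra).
  (* Doubled, this bounds the tail by (1 - |a_1|) c_1 w r, which together with the first term |a_1|
     c_1 w r makes exactly c_1 w r. *)
  assert ((1 - Cmod (a 1%nat)) * (w * r) * frac_tail alpha r
          <= (1 - Cmod (a 1%nat)) * (w * r) * (frac_coef alpha 1 / 2)).
  { apply Rmult_le_compat_l; [apply Rmult_le_pos; lra | easy]. }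
  lra.
Qed.
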